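(* Let $P$ be the transition matrix of a finite irreducible Markov chain with $m$ states, and let $P_0 = ee^T/m$ and, for $i=1,2,\dots,m$, $P_i = P_{i-1}+e_ib_i^T$, where $p_i^T = e_i^TP$ and $b_i^T = p_i^T-e^T/m$ (so $P_m=P$). Assume that each $P_i$ is irreducible. Then the following procedure computes $\Pi = e\pi^T$ (where $\pi^T$ is the stationary probability vector of the chain), the group inverse $A^{\#}$ of $A=I-P$, and the mean first passage time matrix $M$ of the chain. (i) Start with $P_0 = ee^T/m$, which implies $\Pi_0 = ee^T/m$ and $A_0^{\#} = I-ee^T/m$. (ii) For $i=1,2,\dots,m$, let $p_i^T = e_i^TP$, $b_i^T = p_i^T-e^T/m$, $$S_i = I + \frac{1}{1-b_i^TA_{i-1}^{\#}e_i}\,e_ib_i^TA_{i-1}^{\#},\qquad \Pi_i = \Pi_{i-1}S_i,\qquad A_i^{\#} = (I-\Pi_i)A_{i-1}^{\#}S_i .$$ (iii) At $i=m$, let $S=S_m$; then $\Pi = \Pi_{m-1}S$ and $A^{\#} = (I-\Pi)A_{m-1}^{\#}S$. (iv) Compute $M = [I-A^{\#}+EA^{\#}_d]D$, where $E$ is the $m\times m$ matrix with all entries equal to 1 and $D = (\Pi_d)^{-1}$.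
   Context: All matrices are real $m\times m$; $e$ is the column vector of all ones in $\mathbb{R}^m$ and $e_i$ is the $i$-th standard basis column vector. For a square matrix $X$, $X_d$ denotes the diagonal matrix having the same diagonal entries as $X$. A transition matrix is a stochastic matrix (nonnegative entries, each row sum 1). The matrix $P_i$ has its first $i$ rows equal to those of $P$ and its remaining rows equal to $e^T/m$. The stationary probability vector of an irreducible $P$ is the unique row vector $\pi^T$ with $\pi^T(I-P)=0^T$, $\pi^Te=1$ (all its entries are positive). The group inverse $A^{\#}$ of $A=I-P$ is the unique matrix with $AA^{\#}A=A$, $A^{\#}AA^{\#}=A^{\#}$, $AA^{\#}=A^{\#}A$. The mean first passage time matrix is $M=[m_{ij}]$, where $m_{ij}$ is the expected value, given $X_0=i$, of $\min\{n\ge 1: X_n=j\}$ for the Markov chain $(X_n)_{n\ge 0}$ with transition matrix $P$. *)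

(* Defs.v *)
From mathcomp Require Import all_boot all_order all_algebra.
From mathcomp Require Import all_classical all_reals all_analysis.

Set Implicit Arguments.
Unset Strict Implicit.
Unset Printing Implicit Defensive.

Import Order.TTheory GRing.Theory Num.Theory.
Local Open Scope classical_set_scope.
Local Open Scope ring_scope.

Section Matrices.
Variables (R : realType) (m : nat).
Implicit Types (P X A : 'M[R]_m) (k : nat).

Definition stochastic P :=
  (forall i j, 0 <= P i j) /\ (forall i, \sum_j P i j = 1).

Definition irreducible P := forall i j, exists n : nat, 0 < (P ^+ n) i j.

(* The column vector e of all ones. *)
Definition ones : 'cV[R]_m := const_mx 1.

(* The basis column vector with its 1 in row k; rows are numbered from 0 and
   k is a natural number, so this is the zero vector when m <= k. *)
Definition basis_col k : 'cV[R]_m := \col_i (i == k :> nat)%:R.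

(* X_d *)
Definition diag_part X : 'M[R]_m := diag_mx (\row_i X i i).

(* pi is the only row vector with pi (I - P) = 0 and pi e = 1. *)
Definition is_stationary_vector P : 'rV[R]_m -> Prop :=
  unique (fun pi => pi *m (1%:M - P) = 0 /\ pi *m ones = 1%:M).

(* X is the only matrix satisfying the three equations of the group inverse
   of A. *)
Definition is_group_inverse A : 'M[R]_m -> Prop :=
  unique (fun X => [/\ A *m X *m A = A, X *m A *m X = X & A *m X = X *m A]).

(* e e^T / m *)
Definition uniform_mx : 'M[R]_m := m%:R^-1 *: (ones *m ones^T).

(* The row difference e_k^T P - e^T / m. *)
Definition row_diff P k : 'rV[R]_m :=
  (basis_col k)^T *m P - m%:R^-1 *: ones^T.

(* Since rows are numbered from 0, the step leading from the k-th to the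
   k.+1-st iterate treats row k; only the steps k < m are meaningful. *)
Fixpoint row_update P k : 'M[R]_m :=
  if k is k'.+1 then row_update P k' + basis_col k' *m row_diff P k'
  else uniform_mx.

(* 1 - b^T G e_k, for b^T the k-th row difference. *)
Definition update_denom P k (G : 'M[R]_m) : R :=
  1 - (row_diff P k *m G *m basis_col k) 0 0.

(* S = I + (1 - b^T G e_k)^-1 e_k b^T G *)
Definition update_factor P k (G : 'M[R]_m) : 'M[R]_m :=
  1%:M + (update_denom P k G)^-1 *: (basis_col k *m row_diff P k *m G).

(* The pair (Pi_k, A_k^#) computed by the procedure after k steps. *)
Fixpoint procedure P k : 'M[R]_m * 'M[R]_m :=
  if k is k'.+1 then
    let: (Pi, G) := procedure P k' in
    let S := update_factor P k' G in
    let Pi' := Pi *m S in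
    (Pi', (1%:M - Pi') *m G *m S)
  else (uniform_mx, 1%:M - uniform_mx).

(* [I - G + E G_d] (Pi_d)^-1 *)
Definition passage_formula (Pi G : 'M[R]_m) : 'M[R]_m :=
  (1%:M - G + const_mx 1 *m diag_part G) *m invmx (diag_part Pi).

End Matrices.

Section MeanFirstPassage.
Variables (R : realType) (m : nat).
Local Open Scope ereal_scope.

(* X is a Markov chain with transition matrix P and arbitrary initial law.
   The one-step condition Pr(X_(n+1) = y | X_0 = x_0, ..., X_n = x_n) = P x_n y
   is multiplied out, so that it also covers paths of probability zero. *)
Definition markov_chain (d : measure_display) (T : measurableType d)
    (Pr : probability T R) (P : 'M[R]_m) (X : nat -> T -> 'I_m) : Prop :=
  (forall n (x : 'I_m), measurable (X n @^-1` [set x])) /\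
  (forall n (x : nat -> 'I_m),
     Pr [set w | forall k, (k <= n.+1)%N -> X k w = x k] =
     Pr [set w | forall k, (k <= n)%N -> X k w = x k] * (P (x n) (x n.+1))%:E).

(* min {n >= 1 : X_n w = j}, with value +oo when j is never reached. *)
Definition first_passage_time (T : Type) (X : nat -> T -> 'I_m) (j : 'I_m)
    (w : T) : \bar R :=
  ereal_inf [set n%:R%:E | n in [set n : nat | (1 <= n)%N /\ X n w = j]].

(* The expectation of f given an event A of positive probability. *)
Definition cond_expectation (d : measure_display) (T : measurableType d)
    (Pr : probability T R) (f : T -> \bar R) (A : set T) : \bar R :=
  (\int[Pr]_(w in A) f w) * ((fine (Pr A))^-1)%:E.

(* The expected passage times depend only on P, not on the space carrying the
   chain or on its initial law; all realizations are quantified over. *)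
Definition is_mean_first_passage_matrix (P M : 'M[R]_m) : Prop :=
  forall (d : measure_display) (T : measurableType d) (Pr : probability T R)
         (X : nat -> T -> 'I_m),
    markov_chain Pr P X ->
    forall i j : 'I_m, 0 < Pr (X 0%N @^-1` [set i]) ->
      cond_expectation Pr (first_passage_time X j) (X 0%N @^-1` [set i])
      = (M i j)%:E.

End MeanFirstPassage.

(* Main.v *)
Require Import Defs.
From mathcomp Require Import all_boot all_order all_algebra.
From mathcomp Require Import all_classical all_reals all_analysis.
From mathcomp Require Import measurable_realfun.
From mathcomp Require Import ring lra.
Import Order.TTheory GRing.Theory Num.Theory.
Import numFieldNormedType.Exports.
Local Open Scope ring_scope.

(** The pair [(pi, G)] attached to an irreducible [P] is pinned down by
    [A G = G A = I - e pi], [G e = 0], [pi G = 0] with [A = I - P]; these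
    relations survive a rank-one change of [P] by the Sherman-Morrison formula.
    Its denominator cannot vanish: otherwise [x = G e_k] would satisfy
    [(I - P_(k+1)) x = - pi_k e], so by the maximum principle [x] would be
    constant, hence zero since [pi x = 0], against [b x = 1].

    For the passage times to [j], let [Q] be [P] with column [j] erased.
    The chain started at [i] avoids [j] up to time [n] with probability
    [(Q^n e)_i], so the mean passage time is the sum of this series.  The [j]-th
    column [x] of the passage formula solves [x = e + Q x], is nonnegative by the
    minimum principle, and is therefore the sum of the series. *)

(** * Group inverses of matrices with a one-dimensional kernel, under rank-one updates *)

Definition deflated_inverse {F : fieldType} {m : nat} (A : 'M[F]_m)
    (e : 'cV[F]_m) (pi : 'rV[F]_m) (G : 'M[F]_m) : Prop :=
  [/\ A *m e = 0 /\ pi *m A = 0, pi *m e = 1%:M,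
      A *m G = 1%:M - e *m pi /\ G *m A = 1%:M - e *m pi
    & G *m e = 0 /\ pi *m G = 0].

Section DeflatedInverse.
Context {F : fieldType} {m : nat}.
Implicit Types (A G X Y : 'M[F]_m) (e u : 'cV[F]_m) (pi b : 'rV[F]_m).

(** Multiplying [A G = I - e pi] by [q] on the left gives [0 = q - pi]. *)
Lemma deflated_inverse_left_kernel {A e pi G} {q : 'rV[F]_m} :
  deflated_inverse A e pi G -> q *m A = 0 -> q *m e = 1%:M -> pi = q.
Proof.
move=> [_ _ [AG _] _] qA qe.
have: q *m (A *m G) = 0 by rewrite mulmxA qA mul0mx.
rewrite AG mulmxBr mulmx1 mulmxA qe mul1mx => /eqP.
by rewrite subr_eq0 => /eqP.
Qed.

Lemma deflated_inverse_group_inverse {A e pi G} :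
  deflated_inverse A e pi G ->
  [/\ A *m G *m A = A, G *m A *m G = G & A *m G = G *m A].
Proof.
move=> [[Ae piA] pie [AG GA] [Ge piG]]; split; last by rewrite AG GA.
- by rewrite AG mulmxBl mul1mx -mulmxA piA mulmx0 subr0.
- by rewrite GA mulmxBl mul1mx -mulmxA piG mulmx0 subr0.
Qed.

(** Commutation forces [A X = A X A Y = A Y]; then [X = X A X] can be turned into [Y A Y = Y]. *)
Lemma group_inverse_unique A X Y :
  [/\ A *m X *m A = A, X *m A *m X = X & A *m X = X *m A] ->
  [/\ A *m Y *m A = A, Y *m A *m Y = Y & A *m Y = Y *m A] -> X = Y.
Proof.
move=> [AXA XAX cX] [AYA YAY cY].
have AXY : A *m X = A *m Y.
  by rewrite [LHS]cX -{1}AYA -mulmxA -cY !mulmxA -cX AXA.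
by rewrite -XAX -mulmxA AXY mulmxA -cX AXY cY.
Qed.

(* [d] is the Sherman-Morrison denominator of the perturbation [- u b]. *)
Lemma deflated_inverse_update {A e pi G u b} {d : F}
    (S := 1%:M + d^-1 *: (u *m b *m G)) :
  deflated_inverse A e pi G -> b *m e = 0 -> d != 0 ->
  b *m G *m u = (1 - d)%:M ->
  deflated_inverse (A - u *m b) e (pi *m S)
    ((1%:M - e *m (pi *m S)) *m G *m S).
Proof.
move=> [[Ae piA] pie [AG GA] [Ge piG]] be d0 bGu.
have Se : S *m e = e.
  by rewrite /S mulmxDl mul1mx -scalemxAl -!mulmxA Ge !mulmx0 scaler0 addr0.
(* Since [b e = 0], [b G A = b], so [A - u b = (I - u b G) A], and [S] undoes the left factor. *)
have SA : S *m (A - u *m b) = A.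
  rewrite /S mulmxDl mul1mx -scalemxAl -[u *m b *m G]mulmxA -mulmxA mulmxBr.
  rewrite (mulmxA (b *m G)) bGu -(mulmxA b) GA (mulmxBr b) mulmx1 (mulmxA b e) be mul0mx.
  rewrite subr0 mul_scalar_mx scalerBl scale1r opprB.
  rewrite [b + (_ - _)]addrCA subrr addr0 -scalemxAr scalerA mulVf // scale1r.
  by rewrite subrK.
(* With [Y = u b G], [b G u = 1 - d] gives [Y Y = (1 - d) Y], which makes [S = I + Y / d] the
   inverse of [I - Y]. *)
have AS : (1%:M - u *m b *m G) *m S = 1%:M.
  rewrite /S mulmxDr mulmx1 -scalemxAr mulmxBl mul1mx.
  have -> : u *m b *m G *m (u *m b *m G) = (1 - d) *: (u *m b *m G).
    by rewrite -!mulmxA (mulmxA b) (mulmxA (b *m G)) bGu mul_scalar_mx -scalemxAr.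
  rewrite -[X in d^-1 *: (X - _)]scale1r -scalerBl opprB [1 + (_ - _)]addrCA subrr addr0.
  by rewrite scalerA mulVf // scale1r subrK.
have pSe : pi *m S *m e = 1%:M by rewrite -mulmxA Se.
have A'e : (A - u *m b) *m e = 0 by rewrite mulmxBl Ae -mulmxA be mulmx0 subr0.
split.
- by split=> //; rewrite -mulmxA SA.
- by [].
- split.
    (* The updated matrix kills [e], so only [(A - u b) G S = (I - u b G - e pi) S = I - e pi S]
       remains. *)
    rewrite !(mulmxA (A - u *m b)) mulmxBr mulmx1 (mulmxA _ e) A'e mul0mx subr0.
    by rewrite mulmxBl AG addrAC mulmxBl AS mulmxA.
  rewrite -(mulmxA _ S) SA -mulmxA GA mulmxBl mul1mx mulmxBr mulmx1.
  by rewrite -(mulmxA e (pi *m S)) (mulmxA (pi *m S) e) pSe mul1mx opprB addrA subrK.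
- split; first by rewrite -!mulmxA Se Ge mulmx0.
  rewrite !(mulmxA (pi *m S)) mulmxBr mulmx1 (mulmxA _ e) pSe mul1mx subrr.
  by rewrite !mul0mx.
Qed.

End DeflatedInverse.

(** * Maximum principle and stationary vectors of stochastic matrices *)

Section Stochastic.
Context {R : realType} {m : nat}.
Implicit Types (P Q : 'M[R]_m) (x : 'cV[R]_m).

Lemma stochastic_ones {P} : stochastic P -> P *m ones R m = ones R m.
Proof.
move=> [_ P1]; apply/matrixP=> i j; rewrite !mxE -[RHS](P1 i).
by apply: eq_bigr => k _; rewrite mxE mulr1.
Qed.

Lemma stochastic_exp {P} n : stochastic P -> stochastic (P ^+ n).
Proof.
move=> sP; elim: n => [|n [IH0 IH1]].
  split=> [i j|i]; first by rewrite expr0 mxE ler0n.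
  rewrite expr0 (bigD1 i) //= big1 ?addr0 ?mxE ?eqxx // => j ji.
  by rewrite mxE eq_sym (negPf ji).
rewrite exprS; split=> [i j|i].
  by rewrite mxE sumr_ge0 // => k _; rewrite mulr_ge0 // (sP.1).
rewrite -[RHS](sP.2 i).
under eq_bigr do rewrite mxE.
rewrite exchange_big; apply: eq_bigr => k _.
by rewrite -mulr_sumr IH1 mulr1.
Qed.

(* Maximum principle: row [i0] exhibits the maximal entry as an average of the
   entries, minus [c]. *)
Lemma stochastic_drift_le0 P x (c : R) :
  (0 < m)%N -> stochastic P -> (1%:M - P) *m x = - c *: ones R m -> c <= 0.
Proof.
move=> m0 [P0 P1] xE.
pose i0 := [arg max_(i > Ordinal m0) x i 0]%O.
have xi0 i : x i 0 <= x i0 0.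
  by rewrite /i0; case: arg_maxP => //= k _; apply.
have := congr1 (fun y : 'cV_m => y i0 0) xE.
rewrite /= mulmxBl mul1mx !mxE mulr1 => {}xE.
have : \sum_j P i0 j * x j 0 <= x i0 0.
  rewrite -[leRHS]mul1r -(P1 i0) mulr_suml; apply: ler_sum => j _.
  by rewrite ler_wpM2l.
move: xE; lra.
Qed.

(** The one-sided bound applied to [x] and to [- x]. *)
Lemma stochastic_drift_eq0 {P x} {c : R} :
  (0 < m)%N -> stochastic P -> (1%:M - P) *m x = c *: ones R m -> c = 0.
Proof.
move=> m0 sP xE; apply/eqP; rewrite eq_le; apply/andP; split.
  by apply: (@stochastic_drift_le0 P (- x)) => //; rewrite mulmxN xE scaleNr.
rewrite -oppr_le0; apply: (@stochastic_drift_le0 P x) => //; by rewrite opprK.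
Qed.

(** Every [P^n] fixes [x], so the maximal entry is an average of all entries; irreducibility gives
    each [j] a positive weight in one of these averages. *)
Lemma irreducible_harmonic_const {P x} :
  (0 < m)%N -> stochastic P -> irreducible P -> (1%:M - P) *m x = 0 ->
  exists t, x = t *: ones R m.
Proof.
move=> m0 sP iP xE.
have Px n : P ^+ n *m x = x.
  elim: n => [|n IH]; first by rewrite expr0 mul1mx.
  rewrite exprS -mulmxA IH; move/eqP: xE.
  by rewrite mulmxBl mul1mx subr_eq0 => /eqP.
pose i0 := [arg max_(i > Ordinal m0) x i 0]%O.
have xi0 i : x i 0 <= x i0 0.
  by rewrite /i0; case: arg_maxP => //= k _; apply.
exists (x i0 0); apply/matrixP=> j k; rewrite ord1 !mxE mulr1.
have [n nP] := iP i0 j.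
have [Q0 Q1] := stochastic_exp n sP.
have /eqP : \sum_k (P ^+ n) i0 k * (x i0 0 - x k 0) = 0.
  under eq_bigr do rewrite mulrBr.
  rewrite sumrB -mulr_suml Q1 mul1r.
  by have := congr1 (fun y : 'cV_m => y i0 0) (Px n); rewrite !mxE => ->; rewrite subrr.
rewrite psumr_eq0; last by move=> l _; rewrite mulr_ge0 // subr_ge0.
move=> /allP /(_ j); rewrite mem_index_enum => /(_ isT) /=.
by rewrite mulf_eq0 (gt_eqF nP) /= subr_eq0 eq_sym => /eqP.
Qed.

(** The signs of [pi] are not known in advance, so the argument runs on [|pi|]: mass at some [i]
    with [pi_i] nonzero reaches [j] under a suitable [P^n]. *)
Lemma stationary_neq0 P (pi : 'rV[R]_m) j :
  stochastic P -> irreducible P -> pi *m (1%:M - P) = 0 ->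
  pi *m ones R m = 1%:M -> pi 0 j != 0.
Proof.
move=> sP iP piE pie.
have piP n : pi *m P ^+ n = pi.
  elim: n => [|n IH]; first by rewrite expr0 mulmx1.
  rewrite exprSr mulmxA IH; move/eqP: piE.
  by rewrite mulmxBr mulmx1 subr_eq0 eq_sym => /eqP.
have [i pii] : exists i, pi 0 i != 0.
  apply/existsP; apply: contraT; rewrite negb_exists => /forallP pi0.
  have := congr1 (fun y : 'M[R]_1 => y 0 0) pie.
  rewrite !mxE big1 => [/eqP|k _]; first by rewrite eq_sym oner_eq0.
  by move: (pi0 k); rewrite negbK => /eqP ->; rewrite mul0r.
have [n nP] := iP i j.
have [Q0 Q1] := stochastic_exp n sP.
(* The triangle inequality [|pi| <= |pi| P^n] is an equality, since both sides
   have the same sum. *)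
have le k : `|pi 0 k| <= \sum_l `|pi 0 l| * (P ^+ n) l k.
  rewrite -{1}(piP n) mxE (le_trans (ler_norm_sum _ _ _)) //.
  by apply: ler_sum => l _; rewrite normrM [X in _ * X]ger0_norm.
have /eqP : \sum_k (\sum_l `|pi 0 l| * (P ^+ n) l k - `|pi 0 k|) = 0.
  rewrite sumrB exchange_big /=.
  under eq_bigr do rewrite -mulr_sumr Q1 mulr1.
  by rewrite subrr.
rewrite psumr_eq0; last by move=> l _; rewrite subr_ge0.
move=> /allP /(_ j); rewrite mem_index_enum => /(_ isT) /=.
rewrite subr_eq0 => /eqP; rewrite -normr_gt0 => <-.
rewrite (bigD1 i) //=; apply: ltr_pwDl; first by rewrite mulr_gt0 ?normr_gt0.
by apply: sumr_ge0 => l _; rewrite mulr_ge0.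
Qed.

End Stochastic.

(** * The iterates of the procedure *)

Section Procedure.
Context {R : realType} {m : nat}.
Variable P : 'M[R]_m.

Lemma uniform_mxE i j : uniform_mx R m i j = m%:R^-1.
Proof. by rewrite !mxE big_ord1 !mxE !mulr1. Qed.

Lemma row_diffE (i : 'I_m) j : row_diff P i 0 j = P i j - m%:R^-1.
Proof.
rewrite !mxE (bigD1 i) //= !mxE eqxx mul1r big1 ?addr0 ?mulr1 // => k ki.
by rewrite !mxE -val_eqE /= in ki *; rewrite (negPf ki) mul0r.
Qed.

Lemma row_updateE k i j : (k <= m)%N ->
  row_update P k i j = if (i < k)%N then P i j else m%:R^-1.
Proof.
elim: k => [|k IH] km; first by rewrite /= uniform_mxE.
rewrite /= mxE IH ?(ltnW km) // ltnS [(i <= k)%N]leq_eqVlt mxE big_ord1 mxE.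
case: eqVneq => /= [ik|ik]; last by rewrite mul0r addr0.
by rewrite -ik ltnn row_diffE mul1r addrC subrK.
Qed.

Lemma row_update_last : row_update P m = P.
Proof. by apply/matrixP => i j; rewrite row_updateE ?ltn_ord. Qed.

Hypotheses (m0 : (0 < m)%N) (sP : stochastic P).

Lemma stochastic_row_update {k} : (k <= m)%N -> stochastic (row_update P k).
Proof.
move=> km; split=> [i j|i].
  by rewrite row_updateE //; case: ifP => _; rewrite ?invr_ge0 ?ler0n ?(sP.1).
under eq_bigr do rewrite row_updateE //.
case: (i < k)%N; first exact: (sP.2).
by rewrite sumr_const card_ord -[LHS]mulr_natr mulVf // pnatr_eq0 -lt0n.
Qed.

Lemma uniform_ones : m%:R^-1 *: (ones R m)^T *m ones R m = 1%:M.
Proof.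
rewrite -scalemxAl; apply/matrixP => i j; rewrite !ord1 !mxE.
under eq_bigr do rewrite !mxE mulr1.
by rewrite sumr_const card_ord mulVf // pnatr_eq0 -lt0n.
Qed.

(** Both rows in the difference sum to 1; for [k >= m] the vector [basis_col] is zero and the
    product would be -1. *)
Lemma row_diff_ones {k} : (k < m)%N -> row_diff P k *m ones R m = 0.
Proof.
move=> km; rewrite mulmxBl uniform_ones -mulmxA stochastic_ones //.
apply/matrixP => i j; rewrite !ord1 !mxE (bigD1 (Ordinal km)) //= !mxE eqxx.
rewrite big1 ?addr0 ?mulr1 ?subrr // => l; rewrite -val_eqE /= => lk.
by rewrite !mxE (negPf lk) mul0r.
Qed.

(** [I - e e^T / m] is idempotent, hence its own group inverse. *)
Lemma deflated_inverse_uniform :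
  deflated_inverse (1%:M - uniform_mx R m) (ones R m) (m%:R^-1 *: (ones R m)^T)
    (1%:M - uniform_mx R m).
Proof.
have UE : uniform_mx R m = ones R m *m (m%:R^-1 *: (ones R m)^T).
  by rewrite -scalemxAr.
have AA : (1%:M - uniform_mx R m) *m (1%:M - uniform_mx R m) = 1%:M - uniform_mx R m.
  rewrite mulmxBr mulmx1 mulmxBl mul1mx {3 4}UE mulmxA.
  by rewrite -(mulmxA (ones R m)) uniform_ones mulmx1 -UE subrr subr0.
have Ae : (1%:M - uniform_mx R m) *m ones R m = 0.
  by rewrite mulmxBl mul1mx UE -mulmxA uniform_ones mulmx1 subrr.
have piA : m%:R^-1 *: (ones R m)^T *m (1%:M - uniform_mx R m) = 0.
  by rewrite mulmxBr mulmx1 UE mulmxA uniform_ones mul1mx subrr.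
by split; rewrite -?UE ?AA ?uniform_ones.
Qed.

Lemma update_denom_neq0 {k} {G : 'M[R]_m} { pi : 'rV[R]_m} :
  (k < m)%N -> irreducible (row_update P k.+1) ->
  deflated_inverse (1%:M - row_update P k) (ones R m) pi G ->
  update_denom P k G != 0.
Proof.
move=> km iQ [[Ae piA] pie [AG GA] [Ge piG]].
apply/negP; rewrite subr_eq0 eq_sym => /eqP d1.
have bGe : row_diff P k *m G *m basis_col R m k = 1%:M.
  by rewrite [LHS]mx11_scalar d1.
(* [x] solves the Poisson equation [(I - P_(k+1)) x = - pi_k e]. *)
pose x := G *m basis_col R m k.
have xE : (1%:M - row_update P k.+1) *m x = - (pi *m basis_col R m k) 0 0 *: ones R m.
  (* As [b G e_k = 1], the perturbation cancels the term [e_k] of [A G e_k = e_k - e (pi e_k)]. *)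
  rewrite /= opprD addrA mulmxBl /x mulmxA AG -mulmxA (mulmxA _ G) bGe mulmx1.
  rewrite mulmxBl mul1mx addrAC subrr sub0r -mulmxA.
  by rewrite {1}[pi *m _]mx11_scalar mul_mx_scalar scaleNr.
have c0 := stochastic_drift_eq0 m0 (stochastic_row_update km) xE.
rewrite c0 scale0r in xE.
have [t xt] := irreducible_harmonic_const m0 (stochastic_row_update km) iQ xE.
have /eqP : pi *m x = 0 by rewrite /x mulmxA piG mul0mx.
rewrite xt -scalemxAr pie scalemx1 => /eqP /matrixP /(_ 0 0).
rewrite !mxE mulr1n => t0.
have /eqP := congr1 (fun y : 'M[R]_1 => y 0 0) bGe.
by rewrite /= -mulmxA -/x xt t0 scale0r mulmx0 !mxE eq_sym oner_eq0.
Qed.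

(** Loop invariant: with [Pi = e pi], one step of the procedure is [deflated_inverse_update] for
    [u = e_k] and [b] the row difference. *)
Lemma procedure_deflated_inverse k :
  (forall k : nat, (k <= m)%N -> irreducible (row_update P k)) -> (k <= m)%N ->
  exists2 pi : 'rV[R]_m, (procedure P k).1 = ones R m *m pi
    & deflated_inverse (1%:M - row_update P k) (ones R m) pi (procedure P k).2.
Proof.
move=> iQ; elim: k => [|k IH] km.
  exists (m%:R^-1 *: (ones R m)^T); first by rewrite /= -scalemxAr.
  exact: deflated_inverse_uniform.
have [pi PiE defl] := IH (ltnW km).
have d0 := update_denom_neq0 km (iQ _ km) defl.
exists (pi *m update_factor P k (procedure P k).2).
  by rewrite /=; case: procedure PiE => /= ? ? ->; rewrite mulmxA.
have bGu : row_diff P k *m (procedure P k).2 *m basis_col R m k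
    = (1 - update_denom P k (procedure P k).2)%:M.
  by rewrite [LHS]mx11_scalar /update_denom opprB addrC subrK.
have := deflated_inverse_update defl (row_diff_ones km) d0 bGu.
rewrite /= opprD addrA; case: procedure PiE => /= Pi G ->.
by rewrite /update_factor !mulmxA.
Qed.

End Procedure.

Lemma deflated_inverse_spec {R : realType} {m : nat} {Q G : 'M[R]_m} { pi : 'rV[R]_m} :
  deflated_inverse (1%:M - Q) (ones R m) pi G ->
  is_stationary_vector Q pi /\ is_group_inverse (1%:M - Q) G.
Proof.
move=> defl; have gi := deflated_inverse_group_inverse defl.
split; last by split=> // X; exact: group_inverse_unique.
split=> [|q [qA qe]]; last exact: deflated_inverse_left_kernel defl qA qe.
by case: defl => [[]].
Qed.

(** Transitions of the chain killed on entering [j]. Row [j] is kept, so that a start at [j] leads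
    to a first return time. *)
Definition taboo {R : realType} {m : nat} (P : 'M[R]_m) (j : 'I_m) : 'M[R]_m :=
  \matrix_(i, k) if k == j then 0 else P i k.

(** * The first-step equation of the passage formula *)

Section PassageFormula.
Context {R : realType} {m : nat}.
Variables (P G : 'M[R]_m) (pi : 'rV[R]_m).
Hypotheses (sP : stochastic P) (pi0 : forall j, pi 0 j != 0).
Hypothesis (defl : deflated_inverse (1%:M - P) (ones R m) pi G).

Lemma diag_part_ones_mul : diag_part (ones R m *m pi) = diag_mx pi.
Proof.
congr diag_mx; apply/rowP => j.
by rewrite !mxE big_ord1 mxE mul1r.
Qed.

Lemma diag_mx_mulVr :
  diag_mx pi *m diag_mx (\row_j (pi 0 j)^-1) = 1%:M.
Proof.
rewrite mulmx_diag -diag_const_mx; congr diag_mx; apply/rowP => j.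
by rewrite !mxE mulfV.
Qed.

Lemma diag_part_ones_mul_unit : diag_part (ones R m *m pi) \in unitmx.
Proof. by rewrite diag_part_ones_mul; case: (mulmx1_unit diag_mx_mulVr). Qed.

Lemma passage_formulaE i j :
  passage_formula (ones R m *m pi) G i j
    = ((i == j)%:R - G i j + G j j) / pi 0 j.
Proof.
have -> : passage_formula (ones R m *m pi) G
    = (1%:M - G + const_mx 1 *m diag_part G) *m diag_mx (\row_j (pi 0 j)^-1).
  congr (_ *m _); rewrite diag_part_ones_mul -[LHS]mulmx1 -diag_mx_mulVr.
  by rewrite mulKmx -?diag_part_ones_mul ?diag_part_ones_mul_unit.
by rewrite !mul_mx_diag !mxE mul1r.
Qed.

(** For the passage formula [M], entry [(i, j)] of [A G = I - e pi] gives
    [(P M)_ij = m_ij - 1 + P_ij / pi_j]; erasing column [j] removes the last term. *)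
Lemma passage_formula_first_step j :
  col j (passage_formula (ones R m *m pi) G)
    = ones R m + taboo P j *m col j (passage_formula (ones R m *m pi) G).
Proof.
case: defl => _ _ [AG _] _.
apply/colP => i; rewrite [in RHS]mxE [in LHS]mxE passage_formulaE.
have -> : ones R m i 0 = 1 by rewrite mxE.
(* The omitted summand is [P i j] times the diagonal entry [1 / pi_j] of the passage formula. *)
have -> : (taboo P j *m col j (passage_formula (ones R m *m pi) G)) i 0
    = (\sum_k P i k * ((k == j)%:R - G k j + G j j) - P i j) / pi 0 j.
  rewrite mxE mulrBl mulr_suml (bigD1 j) //= [in RHS](bigD1 j) //=.
  rewrite [in LHS]mxE !eqxx mul0r add0r subrK mulr1 addrAC subrr add0r.
  apply: eq_bigr => k kj.
  by rewrite [taboo P j i k]mxE [X in _ * X = _]mxE passage_formulaE mulrA (negPf kj).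
have -> : \sum_k P i k * ((k == j)%:R - G k j + G j j)
    = P i j - (P *m G) i j + G j j.
  under eq_bigr do rewrite mulrDr mulrBr.
  rewrite big_split sumrB /= -mulr_suml (sP.2 i) mul1r [(P *m G) i j]mxE.
  congr (_ - _ + _); rewrite (bigD1 j) //= eqxx mulr1 big1 ?addr0 // => k kj.
  by rewrite (negPf kj) mulr0.
have : G i j - (P *m G) i j = (i == j)%:R - pi 0 j.
  have := congr1 (fun X : 'M[R]_m => X i j) AG.
  rewrite /= mulmxBl mul1mx mxE [X in _ + X]mxE => ->.
  by rewrite !mxE big_ord1 mxE mul1r.
move=> e; have -> : (P *m G) i j = G i j - (i == j)%:R + pi 0 j by lra.
by field.
Qed.

End PassageFormula.

(** * Neumann series of a substochastic matrix *)

Section Substochastic.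
Context {R : realType} {m : nat}.
Local Open Scope classical_set_scope.
Variables (Q : 'M[R]_m) (x : 'cV[R]_m).
Hypotheses (Q0 : forall i k, 0 <= Q i k) (Q1 : forall i, \sum_k Q i k <= 1).
Hypothesis (xE : x = ones R m + Q *m x).

(* At a negative minimum, [x = 1 + Q x] would exceed the minimum by 1. *)
Lemma first_step_ge0 i : 0 <= x i 0.
Proof.
pose i0 := [arg min_(k < i) x k 0]%O.
have xi0 k : x i0 0 <= x k 0.
  by rewrite /i0; case: arg_minP => //= l _; apply.
apply: (le_trans _ (xi0 i)); rewrite leNgt; apply/negP => neg.
have := congr1 (fun y : 'cV[R]_m => y i0 0) xE.
rewrite /= !mxE => e.
have : x i0 0 <= \sum_k Q i0 k * x k 0.
  apply: (@le_trans _ _ (\sum_k Q i0 k * x i0 0)).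
    by rewrite -mulr_suml; have := Q1 i0; nra.
  by apply: ler_sum => k _; rewrite ler_wpM2l.
by move: e; lra.
Qed.

Lemma substochastic_exp_ge0 n i k : 0 <= (Q ^+ n) i k.
Proof.
elim: n i k => [|n IH] i k; first by rewrite expr0 mxE ler0n.
by rewrite exprS mxE sumr_ge0 // => l _; rewrite mulr_ge0.
Qed.

(** Telescoping: [Q^k e = Q^k x - Q^(k+1) x]. *)
Lemma first_step_iter n :
  \sum_(k < n) Q ^+ k *m ones R m = x - Q ^+ n *m x.
Proof.
elim: n => [|n IH]; first by rewrite big_ord0 expr0 mul1mx subrr.
rewrite big_ord_recr /= IH {2}xE mulmxDr opprD exprSr -mulmxA.
by rewrite [- _ - _]addrC addrA subrK.
Qed.

(** The partial sums are bounded by [x], so the series converges and [Q^n e] tends to 0; the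
    remainder [Q^n x] is at most a constant times [Q^n e]. *)
Lemma neumann_series_ones i :
  (\sum_(0 <= n <oo) ((Q ^+ n *m ones R m) i 0)%R%:E = (x i 0)%R%:E)%E.
Proof.
pose u n : R := (Q ^+ n *m ones R m) i 0.
have uE n : u n = (\sum_k (Q ^+ n) i k)%R.
  by rewrite /u mxE; apply: eq_bigr => k _; rewrite mxE mulr1.
have u0 n : (0 <= u n)%R.
  by rewrite uE sumr_ge0 // => k _; exact: substochastic_exp_ge0.
have Qx0 n : (0 <= (Q ^+ n *m x) i 0)%R.
  rewrite mxE sumr_ge0 // => k _.
  by rewrite mulr_ge0 ?substochastic_exp_ge0 ?first_step_ge0.
have sE n : series u n = (x i 0 - (Q ^+ n *m x) i 0)%R.
  rewrite /series /= big_mkord.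
  have := congr1 (fun y : 'cV[R]_m => y i 0) (first_step_iter n).
  by rewrite /= summxE !mxE => ->.
have cu : cvgn (series u).
  apply: nondecreasing_is_cvgn.
    by apply/nondecreasing_seqP => n; rewrite !seriesEnat /= big_nat_recr //= lerDl.
  by exists (x i 0) => _ [n _ <-]; rewrite sE gerBl.
have u_0 := cvg_series_cvg_0 cu.
(* [C] bounds every entry of [x], because these entries are nonnegative. *)
pose C := (\sum_k x k 0)%R.
have Qx_0 : ((Q ^+ n *m x) i 0)%R @[n --> \oo] --> (0 : R)%R.
  apply: (@squeeze_cvgr _ _ _ _ (fun=> 0%R) (fun n => C * u n)%R).
  - near=> n; rewrite Qx0 /= uE mulr_sumr mxE; apply: ler_sum => k _.
    rewrite mulrC ler_wpM2r ?substochastic_exp_ge0 // /C (bigD1 k) //= lerDl.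
    by rewrite sumr_ge0 // => l _; exact: first_step_ge0.
  - exact: cvg_cst.
  - by rewrite -(mulr0 C); apply: cvgMr.
have sx : series u n @[n --> \oo] --> x i 0.
  under eq_fun do rewrite sE.
  have -> : x i 0 = x i 0 - 0 :> R by rewrite subr0.
  by apply: cvgB => //; rewrite subr0; exact: cvg_cst.
apply/cvg_lim => //.
under eq_fun do rewrite sumEFin.
by apply: cvg_EFin => //; near=> n.
Unshelve. all: by end_near. Qed.

End Substochastic.

(** * Path events and the passage time as a series *)

Section PathEvents.
Local Open Scope classical_set_scope.

Definition path_event {T S : Type} (X : nat -> T -> S) (N : nat) (x : nat -> S)
  : set T := [set w | forall k, (k <= N)%N -> X k w = x k].

(** The window opens just after time [N], where a prescribed path ends; for [N = 0] it skips time 0,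
    as first passage does. *)
Definition avoid_event {T S : Type} (X : nat -> T -> S) (j : S) (N n : nat)
  : set T := [set w | forall k, (N < k <= N + n)%N -> X k w <> j].

(** Tail-sum formula: [avoid_event X j 0 n] is the event that the passage time exceeds [n]. *)
Lemma first_passage_time_series {R : realType} {m : nat} {T : Type}
    (X : nat -> T -> 'I_m) (j : 'I_m) (w : T) :
  first_passage_time R X j w
    = (\sum_(0 <= n <oo) (\1_(avoid_event X j 0 n) w)%:E)%E.
Proof.
have av1 n : avoid_event X j 0 n w -> \1_(avoid_event X j 0 n) w = 1 :> R.
  by move=> an; rewrite indicE mem_set.
have [hit|nh] := pselect (exists h, (0 < h)%N && (X h w == j)); last first.
  rewrite /first_passage_time (_ : [set _ | n in _] = set0) ?ereal_inf0; last first.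
    by apply/seteqP; split=> // y [n [n0 /eqP Xn] _]; apply: nh; exists n; rewrite n0.
  apply/esym/eq_infty => r.
  (* If [j] is never reached, all terms are 1, and [truncn r + 1] of them exceed [r]. *)
  apply: (@le_trans _ _ (\sum_(0 <= n < (Num.truncn r).+1) (\1_(avoid_event X j 0 n) w)%:E)%E).
    rewrite (eq_bigr (fun=> 1%E)); last first.
      move=> n _; rewrite av1 // => k /andP[k0 _] /eqP Xk.
      by apply: nh; exists k; rewrite k0.
    rewrite sumEFin sumr_const_nat subn0 lee_fin.
    by rewrite ltW // truncnS_gt.
  by apply: nneseries_lim_ge => n _ _; rewrite lee_fin indicE ler0n.
have [h0 /andP[h00 /eqP Xh0] h0min] := ex_minnP hit.
have -> : first_passage_time R X j w = h0%:R%:E.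
  apply/eqP; rewrite eq_le; apply/andP; split.
    by apply: ereal_inf_lbound; exists h0.
  apply: le_ereal_inf_tmp => _ [n [n0 Xn] <-].
  by rewrite lee_fin ler_nat h0min // n0 Xn /=.
(* Terms of index below the first hitting time [h0] are 1, the others 0. *)
rewrite (nneseries_split 0 h0); last by move=> k _; rewrite lee_fin indicE ler0n.
rewrite eseries0 ?adde0 => [|n hn _]; last first.
  rewrite indicE memNset // => /(_ h0); rewrite h00 /= => /(_ hn); exact.
rewrite add0n big_nat_cond (eq_bigr (fun=> 1%E)).
  by rewrite -big_nat_cond sumEFin sumr_const_nat subn0.
move=> n /andP[/andP[_ nh0] _]; rewrite av1 // => k /andP[k0 kn] Xk.
by have := h0min k; rewrite k0 Xk eqxx leqNgt (leq_ltn_trans kn nh0) => /(_ isT).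
Qed.

End PathEvents.

(** * Avoidance probabilities and mean passage times of a Markov chain *)

Section Chain.
Local Open Scope classical_set_scope.
Context {R : realType} {m : nat} {d : measure_display} {T : measurableType d}.
Variables (Pr : probability T R) (P : 'M[R]_m) (X : nat -> T -> 'I_m).
Hypothesis mcX : markov_chain Pr P X.

Lemma measurable_path_event N x : measurable (path_event X N x).
Proof.
rewrite (_ : path_event X N x = \bigcap_(k in [set k | (k <= N)%N]) X k @^-1` [set x k]).
  by apply: bigcap_measurableType => k _; exact: mcX.1.
by apply/seteqP; split=> w h k; exact: h.
Qed.

Lemma measurable_avoid_event j N n : measurable (avoid_event X j N n).
Proof.
rewrite (_ : avoid_event X j N n =
  \bigcap_(k in [set k | (N < k <= N + n)%N]) ~` (X k @^-1` [set j])).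
  by apply: bigcap_measurableType => k _; apply: measurableC; exact: mcX.1.
by apply/seteqP; split=> w h k; exact: h.
Qed.

(** Case split on the state [b] at time [N + 1]; the extended path takes the value [b] at all times
    after [N], of which only [N + 1] matters. *)
Lemma path_avoid_eventS j N n (x : nat -> 'I_m) :
  path_event X N x `&` avoid_event X j N n.+1
  = \big[setU/set0]_(b < m | b != j)
      (path_event X N.+1 (fun k => if (k <= N)%N then x k else b)
       `&` avoid_event X j N.+1 n).
Proof.
rewrite -bigcup_seq_cond; apply/seteqP; split=> w.
  move=> [wx wj]; exists (X N.+1 w); rewrite /= ?mem_index_enum.
    by apply/eqP/wj; rewrite ltnS leqnn addnS ltnS leq_addr.
  split=> k.
    by rewrite leq_eqVlt => /orP[/eqP ->|]; rewrite ?ltnn // ltnS => kN; rewrite kN wx.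
  move=> /andP[Nk kn]; apply: wj; rewrite (ltn_trans (ltnSn N) Nk).
  by rewrite addnS -addSn.
move=> [b /= /andP[_ bj] [wx wj]]; split=> k.
  by move=> kN; rewrite wx ?kN // leqW.
move=> /andP[Nk kn]; have [kN|kN] := ltnP N.+1 k.
  by apply: wj; rewrite kN addSn -addnS.
have -> : k = N.+1 by apply/eqP; rewrite eqn_leq kN.
by rewrite wx // ltnn; apply/eqP.
Qed.

(** Stated for all [N] and [x] because each induction step moves one time from the avoidance window
    into the path, where the Markov property applies. *)
Lemma prob_path_avoid j n N (x : nat -> 'I_m) :
  Pr (path_event X N x `&` avoid_event X j N n)
  = (Pr (path_event X N x) * ((taboo P j ^+ n *m ones R m) (x N) 0)%R%:E)%E.
Proof.
elim: n N x => [|n IH] N x.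
  rewrite (_ : avoid_event X j N 0 = setT) ?setIT.
    by rewrite expr0 mul1mx mxE mule1.
  apply/seteqP; split=> // w _ k; rewrite addn0 => /andP[Nk kN].
  by move: (leq_trans Nk kN); rewrite ltnn.
rewrite path_avoid_eventS measure_bigsetU_ord_cond; last 2 first.
- move=> b _; apply: measurableI.
    exact: measurable_path_event.
  exact: measurable_avoid_event.
- move=> b c _ _ [w [[wb _] [wc _]]].
  by have := wb N.+1 (leqnn _); rewrite (wc N.+1 (leqnn _)) ltnn.
have ext b : path_event X N (fun k => if (k <= N)%N then x k else b)
    = path_event X N x.
  by apply/seteqP; split=> w wx k kN; rewrite wx ?kN.
have stepE b : Pr (path_event X N.+1 (fun k => if (k <= N)%N then x k else b)
       `&` avoid_event X j N.+1 n)
    = (fine (Pr (path_event X N x))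
        * (P (x N) b * (taboo P j ^+ n *m ones R m) b 0))%:E.
  rewrite IH [X in (X * _)%E]mcX.2 -/(path_event _ _ _) ext leqnn ltnn -muleA.
  by rewrite !EFinM fineK //; apply: fin_num_measure; exact: measurable_path_event.
rewrite -[in RHS](fineK (fin_num_measure Pr _ (measurable_path_event N x))).
rewrite (eq_bigr _ (fun b _ => stepE b)).
rewrite sumEFin -EFinM -mulr_sumr; congr (_ * _)%:E.
(* Restricting the sum to [b != j] amounts to erasing column [j]. *)
rewrite exprS -mulmxA mxE big_mkcond; apply: eq_bigr => b _.
by rewrite [taboo P j _ _]mxE; case: eqP => _ /=; rewrite ?mul0r.
Qed.

(** The tail-sum series is integrated term by term, each term being [Pr (X_0 = i)] times
    [(Q^n e)_i]; the Neumann series then sums to [x]. *)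
Lemma mean_first_passage i j (x : 'cV[R]_m) :
  stochastic P -> x = ones R m + taboo P j *m x ->
  (0 < Pr (X 0%N @^-1` [set i]))%E ->
  cond_expectation Pr (first_passage_time R X j) (X 0%N @^-1` [set i])
    = (x i 0)%:E.
Proof.
move=> sP xE Pri0.
have mA : measurable (X 0%N @^-1` [set i]) by exact: mcX.1.
have AE : X 0%N @^-1` [set i] = path_event X 0 (fun=> i).
  apply/seteqP; split=> w; last by move=> /(_ 0%N); exact.
  by move=> wi k; rewrite leqn0 => /eqP ->.
have Q0 k l : 0 <= taboo P j k l by rewrite mxE; case: eqP => // _; exact: sP.1.
have Q1 k : \sum_l taboo P j k l <= 1.
  rewrite -(sP.2 k); apply: ler_sum => l _; rewrite mxE.
  by case: eqP => // _; exact: sP.1.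
rewrite /cond_expectation.
under eq_integral do rewrite first_passage_time_series.
rewrite integral_nneseries //; last first.
  move=> n; apply/measurable_EFinP; apply/measurable_funTS/measurable_indicP.
  exact: measurable_avoid_event.
have PrE := fineK (fin_num_measure Pr _ mA).
have stepE n : (\int[Pr]_(w in X 0%N @^-1` [set i])
      (\1_(avoid_event X j 0 n) w)%:E
    = (fine (Pr (X 0%N @^-1` [set i])))%:E
      * ((taboo P j ^+ n *m ones R m) i 0)%R%:E)%E.
  rewrite integral_indic //; last exact: measurable_avoid_event.
  by rewrite PrE setIC AE; exact: prob_path_avoid.
rewrite (eq_eseriesr (fun n _ => stepE n)) nneseriesZl; last first.
  move=> n _; rewrite lee_fin mxE sumr_ge0 // => k _.
  by rewrite mulr_ge0 ?(substochastic_exp_ge0 _ Q0) // mxE.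
rewrite (neumann_series_ones _ _ Q0 Q1 xE) -!EFinM mulrAC mulfV ?mul1r //.
by apply: lt0r_neq0; rewrite -lte_fin PrE.
Qed.

End Chain.

(** * Correctness of the procedure and of the passage formula *)

Theorem mainTheorem5 (R : realType) (m : nat) (P : 'M[R]_m) :
  (0 < m)%N ->
  stochastic P ->
  irreducible P ->
  (forall k : nat, (k <= m)%N -> irreducible (row_update P k)) ->
  let Pi k := (procedure P k).1 in
  let G k := (procedure P k).2 in
  [/\ forall k : nat, (k < m)%N -> update_denom P k (G k) != 0,
      forall k : nat, (k <= m)%N ->
        (exists2 pi : 'rV[R]_m,
           is_stationary_vector (row_update P k) pi & Pi k = ones R m *m pi) /\
        is_group_inverse (1%:M - row_update P k) (G k),
      row_update P m = P,
      (exists2 pi : 'rV[R]_m,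
         is_stationary_vector P pi & Pi m = ones R m *m pi) /\
      is_group_inverse (1%:M - P) (G m)
    & diag_part (Pi m) \in unitmx /\
      is_mean_first_passage_matrix P (passage_formula (Pi m) (G m))].
Proof.
move=> m0 sP iP iQ Pi G.
have Pm := row_update_last P.
have main k : (k <= m)%N ->
    (exists2 pi : 'rV[R]_m,
       is_stationary_vector (row_update P k) pi & Pi k = ones R m *m pi) /\
    is_group_inverse (1%:M - row_update P k) (G k).
  move=> km; have [pi PiE defl] := procedure_deflated_inverse P m0 sP k iQ km.
  by have [? ?] := deflated_inverse_spec defl; split=> //; exists pi.
split=> //.
- move=> k km.
  have [pi _ defl] := procedure_deflated_inverse P m0 sP k iQ (ltnW km).
  exact: (update_denom_neq0 P m0 sP km (iQ _ km) defl).
- by have := main m (leqnn m); rewrite Pm.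
have [pi PiE defl] := procedure_deflated_inverse P m0 sP m iQ (leqnn m).
rewrite Pm in defl.
have pi0 j : pi 0 j != 0.
  by case: (defl) => [[_ piA] pie _ _]; exact: stationary_neq0 sP iP piA pie.
rewrite /Pi PiE; split; first exact: diag_part_ones_mul_unit.
move=> d T Pr X mcX i j Pri0.
have xE := passage_formula_first_step P (G m) pi sP pi0 defl j.
by rewrite (mean_first_passage Pr P X mcX i j _ sP xE Pri0) mxE.
Qed.
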